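(* Let $\aleph$ be an uncountable cardinal, let $\mathscr U$ be a countably incomplete, $\aleph$-good ultrafilter on a set $I$, and let $(K_i)_{i\in I}$ be a family of compact Hausdorff spaces. Then the topological ultracoproduct $(K_i)^{\mathscr U}$ is an $F_\aleph$-space.
   Context: A compact Hausdorff space $K$ is an $F_\aleph$-space if any two disjoint open subsets of $K$, each of which is the union of less than $\aleph$ many closed sets, have disjoint closures. Ultracoproduct: $C(K)$ is the Banach algebra of real-valued continuous functions on $K$ with the sup norm. Given the family $(C(K_i))_{i\in I}$, let $\ell_\infty(C(K_i))$ be the Banach algebra of bounded families with sup norm and coordinatewise product, and let $c_0^{\mathscr U}(C(K_i))$ be the closed ideal of those $(f_i)$ with $\lim_{\mathscr U(i)}\|f_i\|=0$. The quotient $[C(K_i)]_{\mathscr U}=\ell_\infty(C(K_i))/c_0^{\mathscr U}(C(K_i))$ is isometrically isomorphic, as a Banach algebra, to $C(K)$ for some compact space $K$; this $K$ (the maximal ideal space of $[C(K_i)]_{\mathscr U}$ with the relative weak* topology) is called the topological ultracoproduct of $(K_i)_{i\in I}$ and is denoted $(K_i)^{\mathscr U}$. An ultrafilter $\mathscr U$ on $I$ is countably incomplete if there is a decreasing sequence $(I_n)$ of members of $\mathscr U$ with $\bigcap_n I_n=\varnothing$. Let $\operatorname{fin}(S)$ be the set of finite subsets of $S$. A map $f:\operatorname{fin}(S)\to\mathscr U$ is monotone if $f(A)\supset f(B)$ whenever $A\subset B$, and multiplicative if $f(A\cup B)=f(A)\cap f(B)$ for all $A,B$. The ultrafilter $\mathscr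 U$ is $\aleph$-good if for every set $S$ with $|S|<\aleph$ and every monotone $f:\operatorname{fin}(S)\to\mathscr U$ there is a multiplicative $g:\operatorname{fin}(S)\to\mathscr U$ with $g(A)\subset f(A)$ for all $A\in\operatorname{fin}(S)$. *)

(* Defs.v *)
(* Throughout, [R : realType] is the field of real numbers. *)
From HB Require Import structures.
From mathcomp Require Import all_boot all_order all_algebra.
From mathcomp Require Import finmap.
From mathcomp Require Import all_classical all_reals all_analysis.

Set Implicit Arguments.
Unset Strict Implicit.
Unset Printing Implicit Defensive.

Import Order.TTheory GRing.Theory Num.Theory.
Import numFieldNormedType.Exports.

Local Open Scope classical_set_scope.
Local Open Scope ring_scope.
Local Open Scope quotient_scope.

(* A cardinal is represented by a type [aleph] of that cardinality. *)
Definition card_lt (T V : Type) (A : set T) (B : set V) : Prop :=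
  (A #<= B)%card /\ ~ (B #<= A)%card.

Definition union_of_lt_closed (aleph : Type) (X : topologicalType)
    (A : set X) : Prop :=
  exists C : set (set X), [/\ card_lt C [set: aleph],
    forall F, C F -> closed F & A = \bigcup_(F in C) F].

Definition F_aleph_space (aleph : Type) (X : topologicalType) : Prop :=
  [/\ compact [set: X], hausdorff_space X &
    forall A B : set X, open A -> open B ->
      union_of_lt_closed aleph A -> union_of_lt_closed aleph B ->
      A `&` B = set0 -> closure A `&` closure B = set0].

Definition countably_incomplete (I : Type) (U : set_system I) : Prop :=
  exists J : nat -> set I, [/\ forall n, U (J n),
    forall n, J n.+1 `<=` J n & \bigcap_n J n = set0].

Definition fin_monotone (S : choiceType) (I : Type) (f : {fset S} -> set I) :
    Prop :=
  forall A B : {fset S}, (A `<=` B)%fset -> f B `<=` f A.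

Definition fin_multiplicative (S : choiceType) (I : Type)
    (f : {fset S} -> set I) : Prop :=
  forall A B : {fset S}, f (A `|` B)%fset = f A `&` f B.

(* [{classic S}] is [S] with its classical choiceType structure, so that
   [{fset {classic S}}] is the set of finite subsets of an arbitrary [S]. *)
Definition good_filter (aleph : Type) (I : Type) (U : set_system I) : Prop :=
  forall S : Type, card_lt [set: S] [set: aleph] ->
  forall f : {fset {classic S}} -> set I,
    (forall A, U (f A)) -> fin_monotone f ->
  exists g : {fset {classic S}} -> set I,
    [/\ forall A, U (g A), fin_multiplicative g & forall A, g A `<=` f A].

HB.mixin Record isCompactHausdorff K & Topological K := {
  compact_setT : compact [set: K];
  hausdorffT : hausdorff_space K
}.

#[short(type="compactHausdorffType")]
HB.structure Definition CompactHausdorff :=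
  {K of isCompactHausdorff K & Topological K}.

(* Supremum of a nonnegative function; its value is 0 when [T] is empty, so the
   norms below are correct for empty spaces and empty index sets. *)
Definition supr (R : realType) (T : Type) (g : T -> R) : R := sup (range g).

Section supr.
Context {R : realType} {T : Type}.
Implicit Types g : T -> R.

Lemma supr_ub g x : has_ubound (range g) -> g x <= supr g.
Proof. by move=> ub; apply: ub_le_sup => //; exists x. Qed.

Lemma supr_le g M : 0 <= M -> (forall x, g x <= M) -> supr g <= M.
Proof.
move=> M0 gM; have [[x Tx]|T0] := pselect (exists x : T, True).
  by apply: ge_sup => [|_ [y _ <-] //]; exists (g x), x.
rewrite /supr (_ : range g = set0) ?sup0//.
by apply/seteqP; split=> // y [x]; case: T0; exists x.
Qed.

Lemma supr_ge0 g : has_ubound (range g) -> (forall x, 0 <= g x) -> 0 <= supr g.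
Proof.
move=> ub g0; have [[x _]|T0] := pselect (exists x : T, True).
  exact: le_trans (g0 x) (supr_ub x ub).
rewrite /supr (_ : range g = set0) ?sup0//.
by apply/seteqP; split=> // y [x]; case: T0; exists x.
Qed.

End supr.

Lemma seminorm_normrZ (R : realType) (V : lmodType R) (N : V -> R) :
  (forall x, 0 <= N x) -> (forall l x, N (l *: x) <= `|l| * N x) ->
  forall l x, N (l *: x) = `|l| * N x.
Proof.
move=> N0 NZ l x; apply/eqP; rewrite eq_le NZ/=.
have [->|l0] := eqVneq l 0; first by rewrite normr0 mul0r.
rewrite -ler_pdivlMl ?normr_gt0// -normfV.
by apply: le_trans (NZ _ _); rewrite scalerA mulVf// scale1r.
Qed.

Section cfun.
Variables (R : realType) (K : compactHausdorffType).

Definition is_cfun : {pred K -> R} := fun f => `[< continuous (f : K -> R) >].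

Record cfun := Cfun { cfun_val :> K -> R; _ : cfun_val \in is_cfun }.

HB.instance Definition _ := [isSub for cfun_val].
HB.instance Definition _ := [Choice of cfun by <:].

Lemma cfun_continuous (f : cfun) : continuous f.
Proof. by case: f => f /= /asboolP. Qed.

Lemma is_cfun_subring : subring_closed is_cfun.
Proof.
split.
- by apply/asboolP => x; exact: cvg_cst.
- by move=> f g /asboolP cf /asboolP cg; apply/asboolP => x;
    apply: cvgB; [exact: cf|exact: cg].
- by move=> f g /asboolP cf /asboolP cg; apply/asboolP => x;
    apply: cvgM; [exact: cf|exact: cg].
Qed.

HB.instance Definition _ :=
  GRing.isSubringClosed.Build (K -> R) is_cfun is_cfun_subring.

Lemma is_cfun_scaler : GRing.scaler_closed is_cfun.
Proof.
by move=> k f /asboolP cf; apply/asboolP => x; apply: cvgZr; exact: cf.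
Qed.

HB.instance Definition _ :=
  GRing.isScaleClosed.Build R (K -> R) is_cfun is_cfun_scaler.

HB.instance Definition _ :=
  GRing.SubChoice_isSubComPzRing.Build _ _ cfun (subringClosedP _).
HB.instance Definition _ := [SubZmodule_isSubLmodule of cfun by <:].

End cfun.

Section cfun_norm.
Variables (R : realType) (K : compactHausdorffType).
Implicit Types f g : cfun R K.

Definition cfun_norm f : R := supr (fun x => `|f x|).

Lemma cfun_has_ubound f : has_ubound (range (fun x => `|f x|)).
Proof.
have /compact_bounded[M [_ fM]] : compact (range f).
  by apply: continuous_compact compact_setT; apply: continuous_subspaceT;
    exact: cfun_continuous.
exists (M + 1) => _ [x _ <-]; apply: (fM (M + 1)); first by rewrite ltrDl.
by exists x.
Qed.

Lemma cfun_norm_ub f x : `|f x| <= cfun_norm f.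
Proof. exact: supr_ub x (cfun_has_ubound f). Qed.

Lemma cfun_norm_ge0 f : 0 <= cfun_norm f.
Proof. exact: supr_ge0 (cfun_has_ubound f) _. Qed.

Lemma cfun_normD f g : cfun_norm (f + g) <= cfun_norm f + cfun_norm g.
Proof.
apply: supr_le => [|x]; first by rewrite addr_ge0 ?cfun_norm_ge0.
by rewrite (le_trans (ler_normD _ _))// lerD ?cfun_norm_ub.
Qed.

Lemma cfun_normZ (l : R) f : cfun_norm (l *: f) = `|l| * cfun_norm f.
Proof.
apply: seminorm_normrZ => [|{}l {}f]; first exact: cfun_norm_ge0.
apply: supr_le => [|x]; first by rewrite mulr_ge0 ?cfun_norm_ge0.
by rewrite [X in X <= _]normrM ler_wpM2l ?cfun_norm_ub.
Qed.

Lemma cfun_norm_eq0 f : cfun_norm f = 0 -> f = 0.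
Proof.
move=> f0; apply/val_inj/funext => x /=.
by apply/eqP; rewrite -normr_le0 -f0 cfun_norm_ub.
Qed.

HB.instance Definition _ := Lmodule_isNormed.Build R (cfun R K)
  cfun_normD cfun_normZ cfun_norm_eq0.

Lemma cfun_normE f : `|f| = supr (fun x => `|f x|). Proof. by []. Qed.

Lemma cfun_normM f g : `|f * g| <= `|f| * `|g|.
Proof.
apply: supr_le => [|x]; first by rewrite mulr_ge0.
by rewrite normrM ler_pM ?cfun_norm_ub.
Qed.

Lemma cfun_norm1 : `|1 : cfun R K| <= 1.
Proof. by apply: supr_le => // x; rewrite normr1. Qed.

End cfun_norm.

Section linf.
Variables (R : realType) (I : Type) (K : I -> compactHausdorffType).

Definition cfamily := forall i, cfun R (K i).

HB.instance Definition _ := gen_eqMixin cfamily.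
HB.instance Definition _ := gen_choiceMixin cfamily.

Lemma cfamilyP (f g : cfamily) : (forall i, f i = g i) -> f = g.
Proof. exact: functional_extensionality_dep. Qed.

Definition cfamily_add (f g : cfamily) : cfamily := fun i => f i + g i.
Definition cfamily_opp (f : cfamily) : cfamily := fun i => - f i.
Definition cfamily_mul (f g : cfamily) : cfamily := fun i => f i * g i.
Definition cfamily_scale (l : R) (f : cfamily) : cfamily := fun i => l *: f i.

Fact cfamily_addA : associative cfamily_add.
Proof. by move=> f g h; apply: cfamilyP => i; exact: addrA. Qed.
Fact cfamily_addC : commutative cfamily_add.
Proof. by move=> f g; apply: cfamilyP => i; exact: addrC. Qed.
Fact cfamily_add0 : left_id (fun=> 0) cfamily_add.
Proof. by move=> f; apply: cfamilyP => i; exact: add0r. Qed.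
Fact cfamily_addN : left_inverse (fun=> 0) cfamily_opp cfamily_add.
Proof. by move=> f; apply: cfamilyP => i; exact: addNr. Qed.

HB.instance Definition _ := GRing.isZmodule.Build cfamily
  cfamily_addA cfamily_addC cfamily_add0 cfamily_addN.

Fact cfamily_mulA : associative cfamily_mul.
Proof. by move=> f g h; apply: cfamilyP => i; exact: mulrA. Qed.
Fact cfamily_mulC : commutative cfamily_mul.
Proof. by move=> f g; apply: cfamilyP => i; exact: mulrC. Qed.
Fact cfamily_mul1 : left_id (fun=> 1) cfamily_mul.
Proof. by move=> f; apply: cfamilyP => i; exact: mul1r. Qed.
Fact cfamily_mulD : left_distributive cfamily_mul cfamily_add.
Proof. by move=> f g h; apply: cfamilyP => i; exact: mulrDl. Qed.

HB.instance Definition _ := GRing.Zmodule_isComPzRing.Build cfamily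
  cfamily_mulA cfamily_mulC cfamily_mul1 cfamily_mulD.

Fact cfamily_scaleA a b f :
  cfamily_scale a (cfamily_scale b f) = cfamily_scale (a * b) f.
Proof. by apply: cfamilyP => i; exact: scalerA. Qed.
Fact cfamily_scale1 : left_id 1 cfamily_scale.
Proof. by move=> f; apply: cfamilyP => i; exact: scale1r. Qed.
Fact cfamily_scaleDr : right_distributive cfamily_scale +%R.
Proof. by move=> a f g; apply: cfamilyP => i; exact: scalerDr. Qed.
Fact cfamily_scaleDl f : {morph cfamily_scale^~ f : a b / a + b}.
Proof. by move=> a b; apply: cfamilyP => i; exact: scalerDl. Qed.

HB.instance Definition _ := GRing.Zmodule_isLmodule.Build R cfamily
  cfamily_scaleA cfamily_scale1 cfamily_scaleDr cfamily_scaleDl.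

Definition is_linf : {pred cfamily} :=
  fun f => `[< has_ubound (range (fun i => `|f i|)) >].

Record linf := Linf { linf_val : cfamily; _ : linf_val \in is_linf }.

HB.instance Definition _ := [isSub for linf_val].
HB.instance Definition _ := [Choice of linf by <:].

Lemma is_linf_subring : subring_closed is_linf.
Proof.
split.
- by apply/asboolP; exists 1 => _ [i _ <-]; exact: cfun_norm1.
- move=> f g /asboolP[M fM] /asboolP[N gN]; apply/asboolP.
  exists (M + N) => _ [i _ <-]; rewrite (le_trans (ler_normB _ _))// lerD//.
    by apply: fM; exists i.
  by apply: gN; exists i.
- move=> f g /asboolP[M fM] /asboolP[N gN]; apply/asboolP.
  exists (M * N) => _ [i _ <-]; rewrite (le_trans (cfun_normM _ _))// ler_pM//.
    by apply: fM; exists i.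
  by apply: gN; exists i.
Qed.

HB.instance Definition _ :=
  GRing.isSubringClosed.Build cfamily is_linf is_linf_subring.

Lemma is_linf_scaler : GRing.scaler_closed is_linf.
Proof.
move=> l f /asboolP[M fM]; apply/asboolP; exists (`|l| * M) => _ [i _ <-].
by rewrite normrZ ler_wpM2l//; apply: fM; exists i.
Qed.

HB.instance Definition _ :=
  GRing.isScaleClosed.Build R cfamily is_linf is_linf_scaler.

HB.instance Definition _ :=
  GRing.SubChoice_isSubComPzRing.Build _ _ linf (subringClosedP _).
HB.instance Definition _ := [SubZmodule_isSubLmodule of linf by <:].

Implicit Types f g : linf.

Definition linf_norm f : R := supr (fun i => `|linf_val f i|).

Lemma linf_has_ubound f : has_ubound (range (fun i => `|linf_val f i|)).
Proof. by case: f => f /= /asboolP. Qed.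

Lemma linf_norm_ub f i : `|linf_val f i| <= linf_norm f.
Proof. exact: supr_ub i (linf_has_ubound f). Qed.

Lemma linf_norm_ge0 f : 0 <= linf_norm f.
Proof. exact: supr_ge0 (linf_has_ubound f) _. Qed.

Lemma linf_normD f g : linf_norm (f + g) <= linf_norm f + linf_norm g.
Proof.
apply: supr_le => [|i]; first by rewrite addr_ge0 ?linf_norm_ge0.
by rewrite (le_trans (ler_normD _ _))// lerD ?linf_norm_ub.
Qed.

Lemma linf_normZ (l : R) f : linf_norm (l *: f) = `|l| * linf_norm f.
Proof.
apply: seminorm_normrZ => [|{}l {}f]; first exact: linf_norm_ge0.
apply: supr_le => [|i]; first by rewrite mulr_ge0 ?linf_norm_ge0.
by rewrite [X in X <= _]normrZ ler_wpM2l ?linf_norm_ub.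
Qed.

Lemma linf_norm_eq0 f : linf_norm f = 0 -> f = 0.
Proof.
move=> f0; apply/val_inj/cfamilyP => i /=.
by apply/eqP; rewrite -normr_le0 -f0 linf_norm_ub.
Qed.

HB.instance Definition _ := Lmodule_isNormed.Build R linf
  linf_normD linf_normZ linf_norm_eq0.

Lemma linf_normE f : `|f| = supr (fun i => `|linf_val f i|). Proof. by []. Qed.

End linf.

Section ultraproduct.
Variables (R : realType) (I : Type) (U : set_system I) (FU : UltraFilter U).
Variable K : I -> compactHausdorffType.
Local Notation linf := (linf R K).

Definition c0U : {pred linf} :=
  fun f => `[< (fun i => `|linf_val f i|) @ U --> (0 : R) >].

Lemma c0UP (f : linf) :
  f \in c0U <-> forall e : R, 0 < e -> U [set i | `|linf_val f i| < e].
Proof.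
split=> [/asboolP /cvgr0Pnorm_lt f0 e /f0|f0].
  by apply: filterS => i /=; rewrite normr_id.
apply/asboolP/cvgr0Pnorm_lt => e /f0.
by apply: filterS => i /=; rewrite normr_id.
Qed.

Lemma c0U_zmod : zmod_closed c0U.
Proof.
split=> [|f g /c0UP f0 /c0UP g0]; apply/c0UP => e e0.
  by apply: filterE => i /=; rewrite normr0.
have e2 : 0 < e / 2 by rewrite divr_gt0.
apply: filterS (filterI (f0 _ e2) (g0 _ e2)) => i [/= fe ge].
by rewrite (splitr e) (le_lt_trans (ler_normB _ _))// ltrD.
Qed.

HB.instance Definition _ := GRing.isZmodClosed.Build linf c0U c0U_zmod.

Lemma c0U_mul (f g : linf) : g \in c0U -> f * g \in c0U.
Proof.
move=> /c0UP g0; apply/c0UP => e e0.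
have f1 : 0 < `|f| + 1 by rewrite ltr_wpDl.
apply: filterS (g0 _ (divr_gt0 e0 f1)) => i /= gi.
rewrite (le_lt_trans (cfun_normM _ _))//.
rewrite (@le_lt_trans _ _ ((`|f| + 1) * `|linf_val g i|))//.
  by rewrite ler_wpM2r// (le_trans (linf_norm_ub f i))// lerDl.
by rewrite -ltr_pdivlMl// mulrC.
Qed.

Lemma c0U_scale (l : R) (g : linf) : g \in c0U -> l *: g \in c0U.
Proof.
move=> /c0UP g0; apply/c0UP => e e0.
have l1 : 0 < `|l| + 1 by rewrite ltr_wpDl.
apply: filterS (g0 _ (divr_gt0 e0 l1)) => i /= gi.
rewrite normrZ (@le_lt_trans _ _ ((`|l| + 1) * `|linf_val g i|))//.
  by rewrite ler_wpM2r// lerDl.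
by rewrite -ltr_pdivlMl// mulrC.
Qed.

Definition ultraprod := {ideal_quot c0U}.

HB.instance Definition _ := EqQuotient.on ultraprod.
HB.instance Definition _ := GRing.Zmodule.on ultraprod.

Definition to_ultraprod (f : linf) : ultraprod := \pi_ultraprod f.

Local Notation pi := to_ultraprod.

Lemma ultraprod_eqP (f g : linf) : pi f = pi g <-> f - g \in c0U.
Proof.
by rewrite (Quotient.idealrBE c0U); split=> [/eqP//|/eqP].
Qed.

Lemma ultraprod_reprK (x : ultraprod) : pi (repr x) = x.
Proof. exact: reprK. Qed.

Lemma ultraprod_piD (f g : linf) : pi (f + g) = pi f + pi g.
Proof. exact: (Quotient.pi_add c0U). Qed.

Lemma ultraprod_pi0 : pi 0 = 0.
Proof. by rewrite -[pi 0](addrK (pi 0)) -ultraprod_piD addr0 subrr. Qed.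

Definition ultraprod_one : ultraprod := pi 1.
Definition ultraprod_mul (x y : ultraprod) : ultraprod :=
  pi (repr x * repr y).
Definition ultraprod_scale (l : R) (x : ultraprod) : ultraprod :=
  pi (l *: repr x).

Lemma ultraprod_repr (f : linf) : repr (pi f) - f \in c0U.
Proof. by apply/ultraprod_eqP; rewrite ultraprod_reprK. Qed.

Lemma ultraprod_mulE (f g : linf) : ultraprod_mul (pi f) (pi g) = pi (f * g).
Proof.
apply/ultraprod_eqP; set f' := repr _; set g' := repr _.
rewrite (_ : _ - _ = f' * (g' - g) + g * (f' - f)); last first.
  by rewrite !mulrBr addrA [g * f']mulrC [g * f]mulrC subrK.
by rewrite rpredD// c0U_mul// ultraprod_repr.
Qed.

Lemma ultraprod_scaleE (l : R) (f : linf) :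
  ultraprod_scale l (pi f) = pi (l *: f).
Proof.
by apply/ultraprod_eqP; rewrite -scalerBr c0U_scale// ultraprod_repr.
Qed.

Lemma ultraprodW (P : ultraprod -> Prop) :
  (forall f, P (pi f)) -> forall x, P x.
Proof. by move=> Ppi x; rewrite -(ultraprod_reprK x). Qed.

Fact ultraprod_mulA : associative ultraprod_mul.
Proof.
elim/ultraprodW=> f; elim/ultraprodW=> g; elim/ultraprodW=> h.
by rewrite !ultraprod_mulE mulrA.
Qed.
Fact ultraprod_mulC : commutative ultraprod_mul.
Proof.
by elim/ultraprodW=> f; elim/ultraprodW=> g; rewrite !ultraprod_mulE mulrC.
Qed.
Fact ultraprod_mul1 : left_id ultraprod_one ultraprod_mul.
Proof. by elim/ultraprodW=> f; rewrite ultraprod_mulE mul1r. Qed.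
Fact ultraprod_mulD : left_distributive ultraprod_mul +%R.
Proof.
elim/ultraprodW=> f; elim/ultraprodW=> g; elim/ultraprodW=> h.
by rewrite -ultraprod_piD !ultraprod_mulE -ultraprod_piD mulrDl.
Qed.

HB.instance Definition _ := GRing.Zmodule_isComPzRing.Build ultraprod
  ultraprod_mulA ultraprod_mulC ultraprod_mul1 ultraprod_mulD.

Fact ultraprod_scaleA a b x :
  ultraprod_scale a (ultraprod_scale b x) = ultraprod_scale (a * b) x.
Proof. by elim/ultraprodW: x => f; rewrite !ultraprod_scaleE scalerA. Qed.
Fact ultraprod_scale1 : left_id 1 ultraprod_scale.
Proof. by elim/ultraprodW=> f; rewrite ultraprod_scaleE scale1r. Qed.
Fact ultraprod_scaleDr : right_distributive ultraprod_scale +%R.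
Proof.
move=> a; elim/ultraprodW=> f; elim/ultraprodW=> g.
by rewrite -ultraprod_piD !ultraprod_scaleE -ultraprod_piD scalerDr.
Qed.
Fact ultraprod_scaleDl x : {morph ultraprod_scale^~ x : a b / a + b}.
Proof.
move=> a b; elim/ultraprodW: x => f.
by rewrite !ultraprod_scaleE -ultraprod_piD scalerDl.
Qed.

HB.instance Definition _ := GRing.Zmodule_isLmodule.Build R ultraprod
  ultraprod_scaleA ultraprod_scale1 ultraprod_scaleDr ultraprod_scaleDl.

Lemma ultraprod_piM (f g : linf) : pi (f * g) = pi f * pi g.
Proof. by rewrite -ultraprod_mulE. Qed.

Lemma ultraprod_pi1 : pi 1 = 1. Proof. by []. Qed.

Lemma ultraprod_piZ (l : R) (f : linf) : pi (l *: f) = l *: pi f.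
Proof. by rewrite -ultraprod_scaleE. Qed.

(* The quotient norm. *)
Definition ultraprod_norm (x : ultraprod) : R :=
  inf [set `|f| | f in [set f : linf | pi f = x]].

Lemma ultraprod_norm_le (f : linf) : ultraprod_norm (pi f) <= `|f|.
Proof. by apply: ge_inf; [exists 0 => _ [g _ <-]|exists f]. Qed.

Lemma ultraprod_norm_ge (M : R) x :
  (forall f : linf, pi f = x -> M <= `|f|) -> M <= ultraprod_norm x.
Proof.
move=> Mf; apply: lb_le_inf; last by move=> _ [f /Mf ? <-].
by exists `|repr x : linf|, (repr x) => //; exact: ultraprod_reprK.
Qed.

Lemma ultraprod_norm_ge0 x : 0 <= ultraprod_norm x.
Proof. exact: ultraprod_norm_ge. Qed.

Lemma ultraprod_normD x y :
  ultraprod_norm (x + y) <= ultraprod_norm x + ultraprod_norm y.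
Proof.
rewrite -lerBlDr; apply: ultraprod_norm_ge => f <-.
rewrite lerBlDr -lerBlDl; apply: ultraprod_norm_ge => g <-.
rewrite lerBlDl -ultraprod_piD.
by rewrite (le_trans (ultraprod_norm_le _))// ler_normD.
Qed.

Lemma ultraprod_normZ (l : R) x :
  ultraprod_norm (l *: x) = `|l| * ultraprod_norm x.
Proof.
apply: seminorm_normrZ => [|{}l {}x]; first exact: ultraprod_norm_ge0.
have [->|l0] := eqVneq l 0.
  rewrite scale0r normr0 mul0r -ultraprod_pi0.
  by rewrite (le_trans (ultraprod_norm_le _))// normr0.
rewrite -ler_pdivrMl ?normr_gt0//; apply: ultraprod_norm_ge => f <-.
rewrite ler_pdivrMl ?normr_gt0// -normrZ -ultraprod_piZ.
exact: ultraprod_norm_le.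
Qed.

Lemma ultraprod_norm_eq0 x : ultraprod_norm x = 0 -> x = 0.
Proof.
elim/ultraprodW: x => f f0; rewrite -ultraprod_pi0.
apply/ultraprod_eqP; rewrite subr0; apply/c0UP => e e0.
have e2 : 0 < e / 2 by rewrite divr_gt0.
have : exists2 g : linf, pi g = pi f & `|g| < e / 2.
  apply: contrapT => /forall2NP ge; move: e2; apply/negP.
  rewrite -leNgt -f0; apply: ultraprod_norm_ge => g gf.
  by have [//|/negP] := ge g; rewrite -leNgt.
move=> [g /esym/ultraprod_eqP/c0UP fg ge].
apply: filterS (fg _ e2) => i /= fgi.
rewrite -[linf_val f i](subrK (linf_val g i)) (splitr e).
rewrite (le_lt_trans (ler_normD _ _))// ltrD//.
exact: le_lt_trans (linf_norm_ub g i) ge.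
Qed.

HB.instance Definition _ := Lmodule_isNormed.Build R ultraprod
  ultraprod_normD ultraprod_normZ ultraprod_norm_eq0.

(* [ultraprod] is isomorphic to an algebra C(K) of real-valued functions, so its
   maximal ideals are the kernels of the nonzero multiplicative functionals in
   its dual.  On the dual, the weak* topology is that of pointwise convergence
   on [ultraprod]. *)
Definition max_ideal_space : set {ptws ultraprod -> R} :=
  [set phi | [/\ linear (phi : ultraprod -> R^o),
    continuous (phi : ultraprod -> R),
    forall x y, phi (x * y) = phi x * phi y & exists x, phi x != 0]].

Definition ultracoproduct : topologicalType := set_type max_ideal_space.

End ultraproduct.

(* Main.v *)
(* A character of the ultraproduct is positive, since nonnegative functions are
   squares; so its character space is compact and Hausdorff, and every closed
   subset [F] of an open set [A] is separated from the complement of [A] by a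
   bounded family [a] with values in [0, 1].  Write the two disjoint open sets as
   unions of closed sets, both indexed by the same type [T] of cardinality less
   than aleph, and let [a t], [b t] be the corresponding families.  As
   [a s * b t] vanishes on the character space, it is in the ideal, because
   evaluations at points [k_i] of [K i] have ultralimits which are characters.
   Goodness and countable incompleteness give, for each [i], a finite set [l i]
   of indices such that each [t] is in [l i] for almost all [i], and
   [a s * b t <= 1/2] on [K i] for [s] and [t] in [l i].  The difference [h] of
   the maxima of the [a t] and of the [b t] over [l i] then satisfies
   [h * a t >= (a t)^2 - 1/2] and [h * b t <= 1/2 - (b t)^2], so that
   [h >= 1/2] on the first open set and [h <= - 1/2] on the second. *)
Require Import Defs.
From HB Require Import structures.
From mathcomp Require Import all_boot all_order all_algebra.
From mathcomp Require Import finmap.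
From mathcomp Require Import all_classical all_reals all_analysis.
From mathcomp Require Import lra.

Set Implicit Arguments.
Unset Strict Implicit.
Unset Printing Implicit Defensive.

Import Order.TTheory GRing.Theory Num.Theory.
Import numFieldNormedType.Exports.

Local Open Scope classical_set_scope.
Local Open Scope ring_scope.

(** * Continuous functional calculus on bounded families *)

Section functional_calculus.
Variables (R : realType) (I : Type) (K : I -> compactHausdorffType).
Variables (c : R -> R) (cc : continuous c).

Lemma is_cfun_comp (L : compactHausdorffType) (f : cfun R L) :
  c \o f \in @is_cfun R L.
Proof.
apply/asboolP => x.
by apply: (@continuous_comp _ _ _ (cfun_val f)); [exact: cfun_continuous|exact: cc].
Qed.

Definition cfun_comp (L : compactHausdorffType) (f : cfun R L) : cfun R L :=
  Cfun (is_cfun_comp f).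

Lemma is_linf_comp (f : linf R K) :
  (fun i => cfun_comp (linf_val f i)) \in @is_linf R I K.
Proof.
have /compact_bounded[M [_ cM]] : compact (c @` `[- `|f|, `|f|]).
  apply: continuous_compact (@segment_compact _ _ _).
  exact: continuous_subspaceT.
(* The maximum with 0 supplies the nonnegativity that [supr_le] asks for, also when [K i] is
   empty. *)
apply/asboolP; exists (Num.max 0 (M + 1)) => _ [i _ <-].
apply: supr_le => [|x]; first by rewrite le_max lexx.
rewrite le_max; apply/orP; right; apply: (cM (M + 1)); first by rewrite ltrDl.
exists (linf_val f i x) => //=; rewrite in_itv/= -ler_norml.
exact: le_trans (cfun_norm_ub _ _) (linf_norm_ub _ _).
Qed.

Definition linf_comp (f : linf R K) : linf R K := Linf (is_linf_comp f).

End functional_calculus.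

Lemma linf_norm_le (R : realType) (I : Type) (K : I -> compactHausdorffType)
  (f : linf R K) i (x : K i) : `|linf_val f i x| <= `|f|.
Proof. exact: le_trans (cfun_norm_ub _ _) (linf_norm_ub _ _). Qed.

Lemma linfP (R : realType) (I : Type) (K : I -> compactHausdorffType)
  (f g : linf R K) : (forall i x, linf_val f i x = linf_val g i x) -> f = g.
Proof.
by move=> fg; apply/val_inj/cfamilyP => i; apply/val_inj/funext => x; exact: fg.
Qed.

Lemma continuous_pos_part (R : realType) : continuous (fun t : R => Num.max t 0).
Proof. by move=> t; apply: continuous_max; [exact: cvg_id|exact: cvg_cst]. Qed.

(** * Order and lattice properties of characters *)

Section ultracoproduct.
Variables (R : realType) (I : Type) (U : set_system I) (FU : UltraFilter U).
Variable K : I -> compactHausdorffType.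
Local Notation linf := (linf R K).
Local Notation ultraprod := (ultraprod R FU K).
Local Notation c0U := (@c0U R I U K).
Local Notation X := (ultracoproduct R FU K).
Local Notation pi := (@to_ultraprod R I U FU K).
Implicit Types (f g : linf) (p : X).

(** The Gelfand transform, taken on representatives so that pointwise computations in [linf] apply
    directly. *)
Definition eval p f : R := (set_val p : ultraprod -> R) (pi f).

Lemma eval_lin p (l : R) f g : eval p (l *: f + g) = l * eval p f + eval p g.
Proof.
have [lin _ _ _] := set_valP p.
rewrite /eval ultraprod_piD ultraprod_piZ.
exact: lin.
Qed.

Lemma evalM p f g : eval p (f * g) = eval p f * eval p g.
Proof.
have [_ _ mul _] := set_valP p.
by rewrite /eval ultraprod_piM; exact: mul.
Qed.

Lemma evalD p f g : eval p (f + g) = eval p f + eval p g.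
Proof. by have := eval_lin p 1 f g; rewrite scale1r mul1r. Qed.

Lemma eval0 p : eval p 0 = 0.
Proof. by apply: (addrI (eval p 0)); rewrite -evalD !addr0. Qed.

Lemma evalZ p (l : R) f : eval p (l *: f) = l * eval p f.
Proof. by have := eval_lin p l f 0; rewrite eval0 !addr0. Qed.

Lemma evalN p f : eval p (- f) = - eval p f.
Proof. by rewrite -scaleN1r evalZ mulN1r. Qed.

Lemma evalB p f g : eval p (f - g) = eval p f - eval p g.
Proof. by rewrite evalD evalN. Qed.

Lemma eval1 p : eval p 1 = 1.
Proof.
have [_ _ _ []] := set_valP p.
elim/ultraprodW => f f0.
apply: (mulfI f0); rewrite mulr1 -[_ (pi f)]/(eval p f) -evalM.
by rewrite mulr1.
Qed.

Lemma eval_c0U p f : f \in c0U -> eval p f = 0.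
Proof.
move=> f0; have e : pi f = pi 0 by apply/ultraprod_eqP; rewrite subr0.
by rewrite -(eval0 p) /eval e.
Qed.

(* A nonnegative function is a square. *)
Lemma eval_ge0 p f : (forall i x, 0 <= linf_val f i x) -> 0 <= eval p f.
Proof.
move=> f0; pose s := linf_comp (@sqrt_continuous R) f.
suff -> : f = s * s by rewrite evalM -expr2 sqr_ge0.
by apply: linfP => i x; rewrite -[LHS]sqr_sqrtr.
Qed.

Lemma eval_le p f g :
  (forall i x, linf_val f i x <= linf_val g i x) -> eval p f <= eval p g.
Proof.
move=> fg; rewrite -subr_ge0 -evalB; apply: eval_ge0 => i x.
by rewrite [_ x]/= subr_ge0.
Qed.

(** Positivity is applied to [f] between the constant families of values plus and minus its norm.
    This bound places the character space in a product of compact segments. *)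
Lemma eval_norm p f : `|eval p f| <= `|f|.
Proof.
have c (l : R) : eval p (l *: (1 : linf)) = l by rewrite evalZ eval1 mulr1.
rewrite ler_norml -[X in X <= _ <= _]c -[X in _ <= _ <= X]c.
by apply/andP; split; apply: eval_le => i x;
  have := linf_norm_le f x; rewrite ler_norml => /andP[? ?];
  rewrite [X in X <= _]mulr1 || rewrite [X in _ <= X]mulr1.
Qed.

Definition pos_part : linf -> linf := linf_comp (@continuous_pos_part R).

Lemma pos_partE f i x : linf_val (pos_part f) i x = Num.max (linf_val f i x) 0.
Proof. by []. Qed.

(** Since [pos_part f * (pos_part f - f)] vanishes, multiplicativity forces the value at
    [pos_part f] to be 0 or [eval p f]; positivity decides which. *)
Lemma eval_pos_part p f : eval p (pos_part f) = Num.max (eval p f) 0.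
Proof.
have ge0 : 0 <= eval p (pos_part f).
  by apply: eval_ge0 => i x; rewrite pos_partE le_max lexx orbT.
have gef : eval p f <= eval p (pos_part f).
  by apply: eval_le => i x; rewrite pos_partE le_max lexx.
have : eval p (pos_part f * (pos_part f - f)) = 0.
  rewrite (_ : _ * _ = 0) ?eval0//; apply: linfP => i x.
  rewrite [LHS](_ : _ = Num.max (linf_val f i x) 0 *
    (Num.max (linf_val f i x) 0 - linf_val f i x))//.
  by case: leP => _; rewrite ?mul0r// subrr mulr0.
rewrite evalM evalB => /eqP; rewrite mulf_eq0 subr_eq0 => /orP[] /eqP e.
  by move: gef; rewrite e => /max_idPr.
by rewrite e; apply/esym/max_idPl; rewrite -e.
Qed.

(** This is min(max(f, 0), 1), written with [pos_part] so that characters commute with it. *)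
Definition clamp f : linf := 1 - pos_part (1 - pos_part f).

Lemma clamp_itv f i x : 0 <= linf_val (clamp f) i x <= 1.
Proof.
rewrite [linf_val _ _ _](_ : _ =
  1 - Num.max (1 - Num.max (linf_val f i x) 0) 0)//.
have : 0 <= Num.max (linf_val f i x) 0 by rewrite le_max lexx orbT.
by move: (Num.max (linf_val f i x) 0) => t t0; case: (leP (1 - t) 0) => ?; lra.
Qed.

Lemma eval_clamp p f :
  eval p (clamp f) = 1 - Num.max (1 - Num.max (eval p f) 0) 0.
Proof. by rewrite evalB eval_pos_part evalB eval_pos_part eval1. Qed.

End ultracoproduct.

(** * The character space is compact and Hausdorff *)

Lemma fmap_ultra (S T : Type) (h : S -> T) (F : set_system S) :
  UltraFilter F -> UltraFilter (h @ F).
Proof.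
move=> UF; apply: Build_UltraFilter => G PG FG.
apply/seteqP; split=> A; last exact: FG.
move=> GA; have [//|FnA] := in_ultra_setVsetC (h @^-1` A) UF.
have GnA : G (~` A) by exact: FG.
exfalso; apply: (@filter_not_empty _ G PG); rewrite -(setICr A).
exact: filterI.
Qed.

Section topology.
Variables (R : realType) (I : Type) (U : set_system I) (FU : UltraFilter U).
Variable K : I -> compactHausdorffType.
Local Notation linf := (linf R K).
Local Notation c0U := (@c0U R I U K).
Local Notation ultraprod := (ultraprod R FU K).
Local Notation X := (ultracoproduct R FU K).
Local Notation pi := (@to_ultraprod R I U FU K).
Implicit Types (f g : linf) (p q : X).

Lemma continuous_eval f : continuous (fun p : X => eval p f).
Proof.
move=> p.
apply: (@continuous_comp X {ptws ultraprod -> R} R (@set_val _ _)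
  (fun phi => phi (pi f))); first exact: initial_continuous.
exact: (@proj_continuous ultraprod (fun=> R) (pi f)).
Qed.

Lemma cvg_evalP (F : set_system X) p : Filter F ->
  (forall f, eval q f @[q --> F] --> eval p f) -> F --> p.
Proof.
move=> FF Fp A [_ [[B oB <-] Bp BA]].
suff cvp : (set_val : X -> {ptws ultraprod -> R}) @ F --> set_val p.
  have FB : F (set_val @^-1` B) by apply: cvp; exact: open_nbhs_nbhs.
  exact: filterS BA FB.
apply/pointwise_cvgP; elim/ultraprodW => f; exact: Fp.
Qed.

Lemma eval_inj p q : (forall f, eval p f = eval q f) -> p = q.
Proof.
by move=> pq; apply/val_inj/funext; elim/ultraprodW => f; exact: pq.
Qed.

Lemma hausdorff_ultracoproduct : hausdorff_space X.
Proof.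
move=> p q pq; apply: eval_inj => f; apply: Rhausdorff => A B pA qB.
have [r [Ar Br]] := pq _ _ (continuous_eval pA) (continuous_eval qB).
by exists (eval r f).
Qed.

Lemma set_val_norm_le p x : `|(set_val p : ultraprod -> R) x| <= `|x|.
Proof.
apply: ultraprod_norm_ge => f <-; exact: eval_norm.
Qed.

(** The norm bound makes [phi] 1-Lipschitz, hence continuous. Functionals obtained as limits are
    recognized as characters in this way. *)
Lemma max_ideal_space_bounded (phi : {ptws ultraprod -> R}) :
  (forall a x y, phi (a *: x + y) = a * phi x + phi y) ->
  (forall x y, phi (x * y) = phi x * phi y) ->
  (exists x, phi x != 0) -> (forall x, `|phi x| <= `|x|) ->
  max_ideal_space phi.
Proof.
move=> lin mul neq0 bnd; split => //.
have linB (x y : ultraprod) : phi (x - y) = phi x - phi y.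
  by have := lin (-1) y x; rewrite scaleN1r mulN1r addrC => ->; rewrite addrC.
move=> x; apply/(@cvgrPdist_lt _ _ _ _ (nbhs_filter x)) => e e0.
have : nbhs x [set y : ultraprod | `|x - y| < e].
  by apply/nbhs_ballP; exists e.
apply: (@filterS _ _ (nbhs_filter x)) => y /= xy.
by rewrite -linB; apply: le_lt_trans xy.
Qed.

(** The Banach-Alaoglu argument: an ultrafilter of characters converges pointwise in a Tychonoff
    product of segments, and the algebraic identities pass to the limit. *)
Lemma compact_ultracoproduct : compact [set: X].
Proof.
rewrite compact_ultra => F UF _.
pose G : set_system {ptws ultraprod -> R} := set_val @ F.
pose box := [set phi : {ptws ultraprod -> R} |
  forall x, `[- `|x|, `|x|]%classic (phi x)].
have cbox : compact box.
  apply: (@tychonoff ultraprod (fun=> R) (fun x => `[- `|x|, `|x|]%classic)).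
  by move=> x; exact: segment_compact.
have Gbox : G box.
  apply: (@filterE _ F) => p x /=; rewrite in_itv/= -ler_norml.
  exact: set_val_norm_le.
move: cbox; rewrite compact_ultra => cbox.
have [phi [boxphi Gphi]] := cbox G (fmap_ultra _ UF) Gbox.
have cvphi x : (set_val p : ultraprod -> R) x @[p --> F] --> phi x.
  exact: cvg_comp Gphi (@proj_continuous ultraprod (fun=> R) x phi).
have lin a x y : phi (a *: x + y) = a * phi x + phi y.
  apply: (cvg_unique (@Rhausdorff R) (cvphi _)).
  rewrite (_ : (fun p => _) = (fun p => a * (set_val p : ultraprod -> R) x
    + (set_val p : ultraprod -> R) y)).
    by apply: cvgD => //; apply: cvgMr.
  by apply/funext => p; have [+ _ _ _] := set_valP p; apply.
have mul x y : phi (x * y) = phi x * phi y.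
  apply: (cvg_unique (@Rhausdorff R) (cvphi _)).
  rewrite (_ : (fun p => _) = (fun p => (set_val p : ultraprod -> R) x
    * (set_val p : ultraprod -> R) y)).
    by apply: cvgM.
  by apply/funext => p; have [_ _ + _] := set_valP p; apply.
(* The value at the unit is kept in the limit, so the limit is not the zero functional. *)
have one : phi (pi 1) = 1.
  apply: (cvg_unique (@Rhausdorff R) (cvphi _)).
  rewrite (_ : (fun p => _) = (fun=> 1)); first exact: cvg_cst.
  by apply/funext => p; exact: eval1.
have phiX : max_ideal_space phi.
  apply: max_ideal_space_bounded => //.
    by exists (pi 1); rewrite one oner_neq0.
  by move=> x; have := boxphi x; rewrite /= in_itv/= -ler_norml.
exists (exist _ phi (mem_set phiX)); split => //.
apply: cvg_evalP => f; exact: cvphi.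
Qed.

End topology.

(** * Ultralimits of evaluations, and Urysohn functions from families *)

Section separation.
Variables (R : realType) (I : Type) (U : set_system I) (FU : UltraFilter U).
Variable K : I -> compactHausdorffType.
Local Notation linf := (linf R K).
Local Notation c0U := (@c0U R I U K).
Local Notation ultraprod := (ultraprod R FU K).
Local Notation X := (ultracoproduct R FU K).
Local Notation pi := (@to_ultraprod R I U FU K).
Implicit Types (f g : linf) (p q : X).

(** [None] covers the indices where no point is selected, in particular those with [K i] empty. *)
Definition eval_at (o : forall i, option (K i)) f i : R :=
  if o i is Some k then linf_val f i k else 0.

Lemma eval_at_le o f i : `|eval_at o f i| <= `|linf_val f i|.
Proof. by rewrite /eval_at; case: (o i) => [k|]; rewrite ?normr0 ?cfun_norm_ub. Qed.

(** Bounded real families converge along an ultrafilter by compactness of segments. The limit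
    depends only on the class of [f], because evaluations of a member of [c0U] tend to 0. *)
Lemma eval_at_cvg o : exists phi : ultraprod -> R,
  forall f, eval_at o f i @[i --> U] --> phi (pi f).
Proof.
have ex (x : ultraprod) : exists l : R, eval_at o (repr x) i @[i --> U] --> l.
  have := @segment_compact R (- `|repr x : linf|) `|repr x : linf|.
  rewrite compact_ultra => /(_ _ (fmap_ultra (eval_at o (repr x)) FU)) [].
    apply: (@filterE _ U) => i /=; rewrite in_itv/= -ler_norml.
    exact: le_trans (eval_at_le _ _ _) (linf_norm_ub _ _).
  by move=> l [_ cvl]; exists l.
exists (fun x => sval (cid (ex x))) => f.
case: (cid _) => l /= cvl.
have cv0 : eval_at o (repr (pi f) - f) i @[i --> U] --> (0 : R).
  apply/cvgr0Pnorm_lt => e e0.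
  have /c0UP/(_ _ e0) := ultraprod_repr FU f.
  by apply: filterS => i; exact: le_lt_trans (eval_at_le _ _ _).
rewrite -[l]subr0.
rewrite (_ : (fun i => _) = (fun i => eval_at o (repr (pi f)) i -
  eval_at o (repr (pi f) - f) i)); first exact: cvgB.
apply/funext => i; rewrite /eval_at; case: (o i) => [k|]; last by rewrite subr0.
rewrite [X in _ - X](_ : _ = linf_val (repr (pi f)) i k - linf_val f i k)//.
by rewrite opprB addrC subrK.
Qed.

(** By contraposition: if the norms of [f] do not tend to 0, points where [f] stays away from 0 have
    an ultralimit of evaluations, which is a character not vanishing at [f]. *)
Lemma eval_eq0 f : (forall p : X, eval p f = 0) -> f \in c0U.
Proof.
move=> f0; apply/c0UP => e e0; apply: contrapT => Une.
(* Halving [e] yields a point directly from the supremum, without using that it is attained. *)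
have ex i : exists o : option (K i), if o is Some k
    then e / 2 <= `|linf_val f i k| else `|linf_val f i| < e.
  have [|fie] := pselect (`|linf_val f i| < e); first by exists None.
  apply: contrapT => no; apply: fie.
  apply: (@le_lt_trans _ _ (e / 2)); last by rewrite ltr_pdivrMr// ltr_pMr// ltr1n.
  apply: supr_le => [|k]; first by rewrite divr_ge0// ltW.
  by rewrite leNgt; apply/negP => fk; apply: no; exists (Some k); exact: ltW.
pose o i := sval (cid (ex i)).
have [phi cvphi] := eval_at_cvg o.
have phif : e / 2 <= `|phi (pi f)|.
  apply: (cvgr_to_ge (cvg_norm (cvphi f))).
  have [//|] := in_ultra_setVsetC [set i | `|linf_val f i| < e] FU.
  apply: filterS => i /= fie; rewrite /eval_at /o.
  by case: (cid _) => -[k|] /=.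
have phiX : max_ideal_space (phi : {ptws ultraprod -> R}).
  apply: max_ideal_space_bounded.
  - move=> a; elim/ultraprodW => g; elim/ultraprodW => h.
    rewrite -ultraprod_piZ -ultraprod_piD.
    apply: (cvg_unique (@Rhausdorff R) (cvphi _)).
    rewrite (_ : (fun i => _) =
      (fun i => a * eval_at o g i + eval_at o h i)).
      by apply: cvgD => //; apply: cvgMr.
    apply/funext => i; rewrite /eval_at.
    by case: (o i) => [//|]; rewrite mulr0 addr0.
  - elim/ultraprodW => g; elim/ultraprodW => h.
    rewrite -ultraprod_piM.
    apply: (cvg_unique (@Rhausdorff R) (cvphi _)).
    rewrite (_ : (fun i => _) =
      (fun i => eval_at o g i * eval_at o h i)); first exact: cvgM.
    apply/funext => i; rewrite /eval_at.
    by case: (o i) => [//|]; rewrite mulr0.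
  - exists (pi f); rewrite -normr_gt0; apply: lt_le_trans phif.
    by rewrite divr_gt0.
  - move=> x; apply: ultraprod_norm_ge => g <-.
    apply: (cvgr_to_le (cvg_norm (cvphi g))).
    apply: (@filterE _ U) => i.
    exact: le_trans (eval_at_le _ _ _) (linf_norm_ub _ _).
have [p pE] : exists p : X, (set_val p : ultraprod -> R) = phi.
  by exists (exist _ phi (mem_set phiX)).
have := lt_le_trans (divr_gt0 e0 (ltr0n _ 2)) phif.
by have := f0 p; rewrite /eval pE => ->; rewrite normr0 ltxx.
Qed.

(* The sets [0 < eval q b] with [0 <= b] and [0 < eval p b] form a filter base
   at [p], since the base is stable under products and finer than the topology
   of pointwise convergence. *)
Lemma eval_bump_pt (A : set X) p : open A -> A p -> exists b : linf,
  [/\ forall q, 0 <= eval q b, 1 < eval p b & forall q, ~ A q -> eval q b = 0].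
Proof.
move=> oA Ap.
pose D := [set b : linf | (forall q, 0 <= eval q b) /\ 0 < eval p b].
pose G := filter_from D (fun b => [set q : X | 0 < eval q b]).
have FG : Filter G.
  apply: filter_from_filter.
    by exists 1; split => [q|]; rewrite eval1.
  move=> b b' [b0 bp] [b'0 b'p]; exists (b * b').
    by split => [q|]; rewrite evalM ?mulr_ge0 ?mulr_gt0.
  move=> q /=; rewrite evalM => bb'.
  have bq : 0 < eval q b.
    by rewrite lt_neqAle b0 andbT; apply: contraTneq bb' => <-; rewrite mul0r ltxx.
  by split => //; rewrite -(pmulr_rgt0 _ bq).
have Gp : G --> p.
  apply: cvg_evalP => f; apply/cvgrPdist_lt => e e0.
  pose c := eval p f *: (1 : linf).
  (* At a character [q], this is positive exactly when [eval q f] is within [e] of [eval p f]. *)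
  pose b := pos_part (e ^+ 2 *: (1 : linf) - (f - c) * (f - c)).
  have bE q : eval q b = Num.max (e ^+ 2 - (eval q f - eval p f) ^+ 2) 0.
    by rewrite eval_pos_part evalB !evalM !evalB !evalZ !eval1 !mulr1 expr2.
  exists b.
    split => [q|]; rewrite bE; first by rewrite le_max lexx orbT.
    by rewrite subrr expr0n subr0 lt_max exprn_gt0.
  move=> q /=; rewrite bE lt_max ltxx orbF subr_gt0.
  move=> ltq; rewrite distrC -(@ltr_pXn2r _ 2)// ?nnegrE ?(ltW e0)//.
  by rewrite real_normK ?num_real.
have [b [b0 bp] bA] := Gp _ (open_nbhs_nbhs (conj oA Ap)).
exists ((2 / eval p b) *: b); split => [q||q nAq].
- by rewrite evalZ mulr_ge0// divr_ge0// ltW.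
- by rewrite evalZ divfK ?gt_eqF// ltr1n.
- rewrite evalZ; have [->|bq] := eqVneq (eval q b) 0; first by rewrite mulr0.
  by case: nAq; apply: bA => /=; rewrite lt_neqAle eq_sym bq b0.
Qed.

(** If no member of [D] is at least 1 on [F], the sets where members of [D] are at most 1 generate a
    proper filter on [F], as sums of members stay in [D]. A cluster point in [F] contradicts the
    bump that exceeds 1 there. *)
Lemma eval_urysohn (A F : set X) : open A -> closed F -> F `<=` A ->
  exists a : linf, [/\ forall i x, 0 <= linf_val a i x <= 1,
    forall q, F q -> eval q a = 1 & forall q, ~ A q -> eval q a = 0].
Proof.
move=> oA cF FA.
pose D := [set b : linf |
  (forall q, 0 <= eval q b) /\ (forall q, ~ A q -> eval q b = 0)].
have [b [b0 bA] bF] : exists2 b, D b & forall q, F q -> 1 <= eval q b.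
  apply: contrapT => no.
  pose G := filter_from D (fun b => F `&` [set q : X | eval q b <= 1]).
  have PG : ProperFilter G.
    apply: filter_from_proper.
      apply: filter_from_filter.
        by exists 0; split => [q|q _]; rewrite eval0.
      move=> b b' [b0 bA] [b'0 b'A]; exists (b + b').
        by split => [q|q nAq]; rewrite evalD ?addr_ge0// bA// b'A// addr0.
      move=> q [Fq]; rewrite /= evalD => bb'; split; split => //=;
        apply: le_trans bb'; by rewrite ?lerDl ?lerDr.
    move=> b Db; apply: contrapT => no'; apply: no; exists b => // q Fq.
    rewrite leNgt; apply/negP => bq; apply: no'; exists q; split => //.
    exact: ltW.
  have /(_ G PG) [|p [Fp clp]] := subclosed_compact cF
      (compact_ultracoproduct (FU := FU) (K := K) (R := R)) (@subsetT _ F).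
    by exists 0 => [|q []//]; split => [q|q _]; rewrite eval0.
  have [b [b0 bp bA]] := eval_bump_pt oA (FA _ Fp).
  have GE : G (F `&` [set q : X | eval q b <= 1]) by exists b.
  have nE : nbhs (eval p b) [set t : R | 1 < t].
    by apply: open_nbhs_nbhs; split => //; exact: open_gt.
  have [q [[_ /= q1] q2]]  := clp _ _ GE (continuous_eval nE).
  by move: q2 => /=; rewrite ltNge q1.
(* So far [b] is controlled only at characters; clamping gives the pointwise bounds on each
   [K i]. *)
exists (clamp b); split => [i x|q Fq|q nAq]; first exact: clamp_itv.
- rewrite eval_clamp (max_idPl (b0 q)).
  by rewrite (max_idPr _) ?subr0// subr_le0 bF.
- by rewrite eval_clamp bA// maxxx subr0 (max_idPl _) ?subrr.
Qed.

End separation.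

(** * Comparison of index sets, and finite selections from a good ultrafilter *)

Lemma surj_total (S T : Type) (s0 : S) (t0 : T) :
  (exists r : S -> T, forall t, exists s, r s = t) \/
  (exists r : T -> S, forall s, exists t, r t = s).
Proof.
(* [P] consists of the graphs of partial bijections. A maximal one is total on one side, since
   otherwise a pair could be added; the default values [s0] and [t0] extend it to a surjection. *)
pose P := [set G : set (S * T) |
  forall x y, G x -> G y -> (x.1 = y.1 <-> x.2 = y.2)].
have [|G [PG Gmax]] := @Zorn_bigcup _ P.
  move=> F FP Ftot x y [A FA Ax] [B FB By].
  by have [AB|BA] := Ftot _ _ FA FB;
    [apply: (FP _ FB) => //; exact: AB|apply: (FP _ FA) => //; exact: BA].
have [ran|nran] := pselect (forall t, exists s, G (s, t)).
  left; have ex s : exists t, forall t', G (s, t') -> t = t'.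
    have [[t Gt]|no] := pselect (exists t, G (s, t)).
      by exists t => t' Gt'; apply: (PG _ _ Gt Gt').1.
    by exists t0 => t' Gt'; case: no; exists t'.
  exists (fun s => sval (cid (ex s))) => t; have [s Gst] := ran t.
  by exists s; case: (cid _) => t' /= /(_ _ Gst).
have [dom|ndom] := pselect (forall s, exists t, G (s, t)).
  right; have ex t : exists s, forall s', G (s', t) -> s = s'.
    have [[s Gs]|no] := pselect (exists s, G (s, t)).
      by exists s => s' Gs'; apply: (PG _ _ Gs Gs').2.
    by exists s0 => s' Gs'; case: no; exists s'.
  exists (fun t => sval (cid (ex t))) => s; have [t Gst] := dom s.
  by exists t; case: (cid _) => s' /= /(_ _ Gst).
move/existsNP: nran => [t nt]; move/existsNP: ndom => [s ns].
exfalso; apply: (Gmax (G `|` [set (s, t)])).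
  split; first by move=> x; left.
  by move=> /(_ (s, t)) Gst; apply: nt; exists s; apply: Gst; right.
move=> [x1 x2] [y1 y2] [Gx|[-> ->]] [Gy|[-> ->]] //=.
- exact: (PG _ _ Gx Gy).
- by split=> e; [case: ns; exists x2; rewrite -e|case: nt; exists x1; rewrite -e].
- by split=> e; [case: ns; exists y2; rewrite e|case: nt; exists y1; rewrite e].
Qed.

(** Multiplicativity splits [g D] into its values at singletons. The empty set is excluded, as no
    singleton then forces [i] into [g fset0]. *)
Lemma fin_multiplicative_in (S : choiceType) (I : Type)
    (g : {fset S} -> set I) i (D : {fset S}) : fin_multiplicative g ->
  D != fset0 -> (forall t, t \in D -> g [fset t]%fset i) -> g D i.
Proof.
move=> gM; elim/finSet_rect: D => D IH /fset0Pn[t tD] gD.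
have [D0|Dn0] := eqVneq (D `\ t)%fset fset0.
  by rewrite -(fsetD1K tD) D0 fsetU0; exact: gD.
rewrite -(fsetD1K tD) gM; split; first exact: gD.
by apply: IH => // [|u /fsetD1P[_ /gD//]]; rewrite fproperD1.
Qed.

(* Countable incompleteness makes only finitely many indices active at each
   point. *)
Lemma good_filter_seq (aleph I T : Type) (U : set_system I)
    (FU : UltraFilter U) (P : T -> T -> set I) :
  countably_incomplete U -> good_filter aleph U ->
  card_lt [set: T] [set: aleph] -> (forall s t, U (P s t)) ->
  exists l : I -> seq {classic T},
    (forall t : {classic T}, U [set i | t \in l i]) /\
    (forall i (s t : {classic T}), s \in l i -> t \in l i -> P s t i).
Proof.
move=> [J [UJ Jdecr J0]] good Taleph UP.
have Jmono m n : (m <= n)%N -> J n `<=` J m.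
  move=> /subnK <-; elim: (n - m)%N => [//|k IH].
  by rewrite addSn; apply: subset_trans (Jdecr _) IH.
(* The factor from [J] will bound the number of active indices, and the intersection imposes [P] on
   all pairs from [D]. An index [t] is active at [i] when [g] of its singleton contains [i]. *)
pose f (D : {fset {classic T}}) := J #|` D| `&`
  \bigcap_(s in [set` D]) \bigcap_(t in [set` D]) P s t.
have Uf D : U (f D).
  apply: filterI; first exact: UJ.
  by do 2 apply: filter_bigI => ? _.
have fmono : fin_monotone f.
  move=> A B /[dup] AB /fsubsetP ABP i [JB PB]; split.
    by apply: Jmono JB; exact: fsubset_leq_card.
  by move=> s sA t tA; apply: PB; exact: ABP.
have [g [Ug gM gf]] := good T Taleph f Uf fmono.
have act i : exists l : seq {classic T}, (forall t, g [fset t]%fset i <-> t \in l)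
    /\ (forall s t, s \in l -> t \in l -> P s t i).
  have [n Jn] : exists n, ~ J n i.
    by apply/existsNP => Ji; have : set0 i by rewrite -J0 => n _; exact: Ji.
  have : finite_set [set t | g [fset t]%fset i].
    (* More than [n] active indices would put [i] in [f D], hence in [J n]. Taking [n.+1] of them
       also makes [D] nonempty. *)
    apply: contrapT => /(infinite_set_fset n.+1)[D Dg nD].
    apply: Jn; apply: (@Jmono _ #|` D|); first exact: ltnW.
    suff [] : f D i by [].
    apply: gf; apply: fin_multiplicative_in => //.
    by rewrite -cardfs_gt0; exact: leq_trans nD.
  move=> /finite_fsetP[D gD]; exists D; split => [t|s t sD tD].
    by rewrite -[g _ i]/([set t | g [fset t]%fset i] t) gD.
  suff [_ /(_ s sD t tD)] : f D i by [].
  apply: gf; apply: fin_multiplicative_in => //; first by apply/fset0Pn; exists s.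
  by move=> u uD; rewrite -[g _ i]/([set t | g [fset t]%fset i] u) gD.
exists (fun i => sval (cid (act i))); split=> [t|i s t].
  by apply: filterS (Ug [fset t]%fset) => i gi /=; case: (cid _) => l /= [<- _].
by case: (cid _) => l /= [_]; exact.
Qed.

(** * Separating functions on a single compact space *)

Lemma cfun_max_seq (R : realType) (L : compactHausdorffType) (T : eqType)
    (a : T -> cfun R L) (l : seq T) : (forall t x, 0 <= a t x <= 1) ->
  exists m : cfun R L, forall x, [/\ 0 <= m x <= 1,
    forall t, t \in l -> a t x <= m x &
    forall M, 0 <= M -> (forall t, t \in l -> a t x <= M) -> m x <= M].
Proof.
move=> a01; elim: l => [|t l [m mP]].
  (* The maximum over the empty list is 0, which is why the bounds [M] are taken nonnegative. *)
  by exists 0 => x; split=> //; rewrite lexx ler01.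
exists (m + cfun_comp (@continuous_pos_part R) (a t - m)) => x.
have -> : (m + cfun_comp (@continuous_pos_part R) (a t - m)) x =
  Num.max (a t x) (m x).
  rewrite [LHS](_ : _ = m x + Num.max (a t x - m x) 0)//.
  by rewrite addr_maxr addr0 addrC subrK.
have [/andP[m0 m1] am mM] := mP x; have /andP[a0 a1] := a01 t x.
split=> [|u|M M0 aM].
- by rewrite le_max m0 orbT ge_max a1.
- by rewrite inE le_max => /orP[/eqP ->|/am ->]; rewrite ?lexx ?orbT.
- rewrite ge_max aM ?mem_head//=; apply: mM => // u ul.
  by apply: aM; rewrite inE ul orbT.
Qed.

(* [h] is the difference of the maxima of the [a t] and of the [b t]. *)
Lemma cfun_separate_seq (R : realType) (L : compactHausdorffType) (T : eqType)
    (a b : T -> cfun R L) (l : seq T) (e : R) : 0 <= e ->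
  (forall t x, 0 <= a t x <= 1) -> (forall t x, 0 <= b t x <= 1) ->
  (forall s t x, s \in l -> t \in l -> a s x * b t x <= e) ->
  exists h : cfun R L, forall x, `|h x| <= 1 /\ forall t, t \in l ->
    a t x * a t x - e <= h x * a t x /\ h x * b t x <= e - b t x * b t x.
Proof.
move=> e0 a01 b01 ab.
have [p pP] := cfun_max_seq l a01; have [q qP] := cfun_max_seq l b01.
exists (p - q) => x; rewrite [(p - q) x](_ : _ = p x - q x)//.
have [/andP[p0 p1] ap pM] := pP x; have [/andP[q0 q1] bq qM] := qP x.
split=> [|t tl]; first by rewrite ler_norml; apply/andP; split; lra.
(* Bounds on the maxima [p] and [q] are checked entry by entry, so a bound on a product is first
   divided by the other factor; a vanishing factor is treated apart. *)
have le_div (u v : R) : 0 <= u -> (0 < u -> v <= e / u) -> v * u <= e.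
  rewrite le_eqVlt => /predU1P[<-|u0 /(_ u0)]; first by rewrite mulr0.
  by rewrite ler_pdivlMr.
have /andP[at0 _] := a01 t x; have /andP[bt0 _] := b01 t x.
have qa : q x * a t x <= e.
  apply: le_div => // apos; apply: qM => [|s sl]; first by rewrite divr_ge0.
  by rewrite ler_pdivlMr// mulrC ab.
have pb : p x * b t x <= e.
  apply: le_div => // bpos; apply: pM => [|s sl]; first by rewrite divr_ge0.
  by rewrite ler_pdivlMr// ab.
have aa : a t x * a t x <= p x * a t x by rewrite ler_wpM2r ?ap.
have bb : b t x * b t x <= q x * b t x by rewrite ler_wpM2r ?bq.
by rewrite !mulrBl; split; lra.
Qed.

(** * Separation in the ultracoproduct and the final theorem *)

Section F_aleph.
Variables (R : realType) (I : Type) (U : set_system I) (FU : UltraFilter U).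
Variable K : I -> compactHausdorffType.
Local Notation linf := (linf R K).
Local Notation c0U := (@c0U R I U K).
Local Notation X := (ultracoproduct R FU K).
Implicit Types (f g : linf) (p q : X).

(** On a set of [U] the family [g - f] equals its positive part, so the two differ by a member of
    [c0U], which characters ignore. *)
Lemma eval_le_ultra p f g :
  U [set i | forall x, linf_val f i x <= linf_val g i x] ->
  eval p f <= eval p g.
Proof.
move=> fg; rewrite -subr_ge0 -evalB.
suff /(eval_c0U p)/eqP : pos_part (g - f) - (g - f) \in c0U.
  by rewrite evalB eval_pos_part subr_eq0 => /eqP <-; rewrite le_max lexx orbT.
apply/c0UP => e e0; apply: filterS fg => i /= fg.
apply: le_lt_trans e0; apply: supr_le => // x.
rewrite [X in `|X|](_ : _ = Num.max (linf_val g i x - linf_val f i x) 0 -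
  (linf_val g i x - linf_val f i x))//.
by rewrite (max_idPl _) ?subr_ge0// subrr normr0.
Qed.

(** The functions given by [cfun_separate_seq] on the spaces [K i] form one bounded family. Each [t]
    lies in [l i] for almost all [i], so their inequalities hold at every character. *)
Lemma linf_separate (aleph T : Type) (a b : T -> linf) :
  countably_incomplete U -> good_filter aleph U ->
  card_lt [set: T] [set: aleph] ->
  (forall t i x, 0 <= linf_val (a t) i x <= 1) ->
  (forall t i x, 0 <= linf_val (b t) i x <= 1) ->
  (forall s t, a s * b t \in c0U) ->
  exists h : linf, forall p t, (eval p (a t) = 1 -> 1 / 2 <= eval p h) /\
    (eval p (b t) = 1 -> eval p h <= - (1 / 2)).
Proof.
move=> inc good Taleph a01 b01 ab0.
(* A threshold [e] gives the bounds 1 - e and e - 1 for [h], so any positive value below 1 leaves a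
   gap. *)
have half0 : 0 < 1 / 2 :> R by rewrite divr_gt0.
pose P s t := [set i | forall x,
  linf_val (a s) i x * linf_val (b t) i x <= 1 / 2].
have UP s t : U (P s t).
  have /c0UP/(_ _ half0) := ab0 s t; apply: filterS => i /= abi x.
  apply: le_trans (ltW abi); apply: le_trans (ler_norm _) _.
  exact: (cfun_norm_ub (linf_val (a s * b t) i)).
have [l [Ul lP]] := good_filter_seq FU inc good Taleph UP.
have hex i := @cfun_separate_seq R (K i) {classic T}
  (fun t => linf_val (a t) i) (fun t => linf_val (b t) i) (l i) _ (ltW half0)
  (fun t => a01 t i) (fun t => b01 t i)
  (fun s t x sl tl => lP i s t sl tl x).
have hlinf : (fun i => sval (cid (hex i))) \in @is_linf R I K.
  apply/asboolP; exists 1 => _ [i _ <-]; apply: supr_le => // x.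
  by case: (cid _) => h /= /(_ x)[].
pose h : linf := Linf hlinf.
pose half : linf := (1 / 2) *: (1 : linf).
have halfE p : eval p half = 1 / 2 by rewrite evalZ eval1 mulr1.
have hP (t : {classic T}) : U [set i | forall x,
    linf_val (a t * a t - half) i x <= linf_val (h * a t) i x /\
    linf_val (h * b t) i x <= linf_val (half - b t * b t) i x].
  apply: filterS (Ul t) => i tl x.
  rewrite [linf_val (a t * a t - half) i x](_ : _ =
    linf_val (a t) i x * linf_val (a t) i x - 1 / 2 * 1)//.
  rewrite [linf_val (half - b t * b t) i x](_ : _ =
    1 / 2 * 1 - linf_val (b t) i x * linf_val (b t) i x)//.
  rewrite [linf_val (h * _) i x](_ : _ = linf_val h i x * linf_val (a t) i x)//.
  rewrite [linf_val (h * _) i x](_ : _ = linf_val h i x * linf_val (b t) i x)//.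
  rewrite mulr1 /h/=; case: (cid _) => hi /= /(_ x)[_ /(_ t tl)].
  exact.
exists h => p t; split=> p1.
- have : eval p (a t * a t - half) <= eval p (h * a t).
    by apply: eval_le_ultra; apply: filterS (hP t) => i + x => /(_ x)[].
  by rewrite evalB !evalM p1 halfE; lra.
- have : eval p (h * b t) <= eval p (half - b t * b t).
    by apply: eval_le_ultra; apply: filterS (hP t) => i + x => /(_ x)[].
  by rewrite evalB !evalM p1 halfE; lra.
Qed.

Lemma closed_eval h (D : set R) : closed D -> closed [set p : X | D (eval p h)].
Proof.
move=> cD; refine (@preimage_closed X R (fun p => eval p h) D _ cD).
by move=> p _; exact: continuous_eval.
Qed.

(** The bounds 1/2 and -1/2 on [h] are closed conditions, so they pass to the closures. Both unions
    share the index type [T] because goodness is applied to a single set of indices. *)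
Lemma disjoint_closure (aleph T : Type) (F G : T -> set X) :
  countably_incomplete U -> good_filter aleph U ->
  card_lt [set: T] [set: aleph] ->
  (forall t, closed (F t)) -> (forall t, closed (G t)) ->
  open (\bigcup_t F t) -> open (\bigcup_t G t) ->
  (\bigcup_t F t) `&` (\bigcup_t G t) = set0 ->
  closure (\bigcup_t F t) `&` closure (\bigcup_t G t) = set0.
Proof.
move=> inc good Taleph cF cG; set A := \bigcup_t F t; set B := \bigcup_t G t.
move=> oA oB AB0.
have exA t := eval_urysohn oA (cF t) (@bigcup_sup _ _ t setT F Logic.I).
have exB t := eval_urysohn oB (cG t) (@bigcup_sup _ _ t setT G Logic.I).
pose a t := sval (cid (exA t)); pose b t := sval (cid (exB t)).
have aP t : [/\ forall i x, 0 <= linf_val (a t) i x <= 1,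
    forall q, F t q -> eval q (a t) = 1 & forall q, ~ A q -> eval q (a t) = 0].
  by rewrite /a; case: (cid _).
have bP t : [/\ forall i x, 0 <= linf_val (b t) i x <= 1,
    forall q, G t q -> eval q (b t) = 1 & forall q, ~ B q -> eval q (b t) = 0].
  by rewrite /b; case: (cid _).
have ab0 s t : a s * b t \in c0U.
  apply: (@eval_eq0 _ _ _ FU) => p; rewrite evalM.
  have [_ _ aA] := aP s; have [_ _ bB] := bP t.
  have [Ap|/aA ->] := pselect (A p); last by rewrite mul0r.
  have [Bp|/bB ->] := pselect (B p); last by rewrite mulr0.
  by have : set0 p by rewrite -AB0.
have [||h hP] := linf_separate inc good Taleph _ _ ab0.
- by move=> t; have [] := aP t.
- by move=> t; have [] := bP t.
have hA : closure A `<=` [set p | 1 / 2 <= eval p h].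
  rewrite closureE; apply: smallest_sub.
    exact: (closed_eval (h := h) (@closed_ge R (1 / 2))).
  by move=> p [t _ Ftp]; apply: (hP p t).1; have [_ + _] := aP t; apply.
have hB : closure B `<=` [set p | eval p h <= - (1 / 2)].
  rewrite closureE; apply: smallest_sub.
    exact: (closed_eval (h := h) (@closed_le R (- (1 / 2)))).
  by move=> p [t _ Gtp]; apply: (hP p t).2; have [_ + _] := bP t; apply.
apply/seteqP; split=> // p [/hA pA /hB pB].
by have := le_trans pA pB; rewrite leNgt gtrN.
Qed.

End F_aleph.

Theorem proposition6p2 (R : realType) (aleph : Type) (I : Type)
    (U : set_system I) (FU : UltraFilter U) (K : I -> compactHausdorffType)
    (aleph_uncountable : ~ countable [set: aleph])
    (U_incomplete : countably_incomplete U)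
    (U_good : good_filter aleph U) :
  F_aleph_space aleph (ultracoproduct R FU K).
Proof.
split; [exact: compact_ultracoproduct|exact: hausdorff_ultracoproduct|].
move=> A B oA oB [C [Clt Ccl AE]] [D [Dlt Dcl BE]] AB0.
(* Empty unions are settled first: [surj_total] needs a default element on each side. *)
have [C0|/set0P[F0 CF0]] := eqVneq C set0.
  by rewrite AE C0 bigcup_set0 closure0 set0I.
have [D0|/set0P[G0 DG0]] := eqVneq D set0.
  by rewrite BE D0 bigcup_set0 closure0 setI0.
pose S : Type := set_type C; pose T : Type := set_type D.
have Slt : card_lt [set: S] [set: aleph].
  by rewrite /card_lt (card_le_eql (card_setT C)) (card_le_eqr (card_setT C)).
have Tlt : card_lt [set: T] [set: aleph].
  by rewrite /card_lt (card_le_eql (card_setT D)) (card_le_eqr (card_setT D)).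
have AS : A = \bigcup_(s : S) set_val s.
  rewrite AE; apply/seteqP; split=> p [F].
    by move=> CF Fp; exists (exist _ F (mem_set CF)).
  by move=> _ Fp; exists (set_val F) => //; exact: set_valP.
have BT : B = \bigcup_(t : T) set_val t.
  rewrite BE; apply/seteqP; split=> p [F].
    by move=> CF Fp; exists (exist _ F (mem_set CF)).
  by move=> _ Fp; exists (set_val F) => //; exact: set_valP.
have Scl (s : S) : closed (set_val s) by apply: Ccl; exact: set_valP.
have Tcl (t : T) : closed (set_val t) by apply: Dcl; exact: set_valP.
have bigcup_surj (V W : Type) (r : V -> W) (E : W -> set (ultracoproduct R FU K)) :
    (forall w, exists v, r v = w) -> \bigcup_w E w = \bigcup_v E (r v).
  move=> rsurj; apply/seteqP; split=> p [w _ Ewp]; last by exists (r w).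
  by have [v rv] := rsurj w; exists v => //; rewrite rv.
(* The index type that surjects onto the other serves for both unions, with repetitions allowed. *)
have [[r rsurj]|[r rsurj]] := surj_total
  (exist _ F0 (mem_set CF0) : S) (exist _ G0 (mem_set DG0) : T).
- have BS : B = \bigcup_(s : S) set_val (r s) by rewrite BT (bigcup_surj _ _ r).
  by rewrite AS BS; apply: (disjoint_closure U_incomplete U_good Slt) => //;
    rewrite -?AS -?BS.
- have AT : A = \bigcup_(t : T) set_val (r t) by rewrite AS (bigcup_surj _ _ r).
  by rewrite AT BT; apply: (disjoint_closure U_incomplete U_good Tlt) => //;
    rewrite -?AT -?BT.
Qed.
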